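(* Let $p\ge 0$ and $m\ge 1$ be integers and let $z$ be a real number with $|z|<1$. Then $$\int_{0}^{2\pi z} x^p\,\mathrm{Cl}_{m}(x)\,dx = -\sum_{k=m+1}^{m+p+1} \frac{(2\pi z)^{p+m+1-k}\,p!\,(-1)^{\lfloor m/2 \rfloor}(-1)^{\lfloor k/2 \rfloor}}{(p+m+1-k)!}\,\mathrm{Cl}_{k}(2\pi z) + \delta_{\lfloor \frac{p+m}{2} \rfloor, \frac{p+m}{2}}(-1)^{\lfloor m/2 \rfloor}\,p!\,(-1)^{\frac{p+m}{2}}\,\zeta(p+m+1).$$
   Context: The generalized Clausen functions of a real variable $\theta$ are $\mathrm{Cl}_{2j}(\theta)=\sum_{k=1}^\infty \frac{\sin(k\theta)}{k^{2j}}$ for $j\ge1$ and $\mathrm{Cl}_{2j+1}(\theta)=\sum_{k=1}^\infty \frac{\cos(k\theta)}{k^{2j+1}}$ for $j\ge0$; for $\mathrm{Cl}_1$ one takes $\theta\notin 2\pi\mathbb{Z}$, and the series is the conditionally convergent sum. $\zeta$ is the Riemann zeta function. $\delta_{a,b}$ is the Kronecker delta ($1$ if $a=b$, $0$ otherwise), so $\delta_{\lfloor n/2\rfloor,n/2}$ is $1$ if $n$ is even and $0$ if $n$ is odd; a term multiplied by it is read as $0$ when $n$ is odd. Convention: $0^0=1$. The value of the integrand at the single point $x=0$ is irrelevant. *)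

(* Defs.v *)
From Stdlib Require Import Reals Factorial.
From Coquelicot Require Import Coquelicot.
Open Scope R_scope.

(* Only [n >= 1] is meaningful.  [Series] is the limit of the partial sums in
   the order of summation, so it covers the conditionally convergent [Cl_1];
   at the excluded points of [Cl_1] the value is a junk default. *)
Definition Cl (n : nat) (theta : R) : R :=
  if Nat.even n
  then Series (fun k : nat => sin (INR (S k) * theta) / INR (S k) ^ n)
  else Series (fun k : nat => cos (INR (S k) * theta) / INR (S k) ^ n).

(* Dirichlet series, valid for real [s > 1]. *)
Definition zeta (s : R) : R :=
  Series (fun k : nat => / Rpower (INR (S k)) s).

Definition kronecker (a b : R) : R := if Req_EM_T a b then 1 else 0.

(* "The integral of [f] from [0] to [b] exists and equals [l]", as the limit of
   [RInt f a b] when [a = e * b] and [e -> 0+]: improper at [0], where [f] may be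
   unbounded (as [Cl_1] is), and oriented, so that [b] may have any sign ([a]
   tends to [0] from the side of [b]).  It agrees with [is_RInt f 0 b l] whenever
   the latter holds for some value, and gives [l = 0] for [b = 0]. *)
Definition is_integral_from_0 (f : R -> R) (b l : R) : Prop :=
  is_RInt_gen f (filtermap (fun e : R => e * b) (at_right 0)) (at_point b) l.

(* Main.v *)
Require Import Defs.
From Stdlib Require Import Reals Factorial.
From Coquelicot Require Import Coquelicot.
From Stdlib Require Import Lra Lia PSeries_reg.
Open Scope R_scope.

(** The factor [(-1) ^ (m / 2)] is exactly what turns the alternating sines and
    cosines of the Clausen functions into one family of phase-shifted sines,
      [D_m(x) = (-1)^(m/2) Cl_m(x) = sum_k sin(k x + m pi/2) / k^m]
    ([signed_Cl], [signed_Cl_eq]).  Differentiating a term divides out one [k]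
    and advances the phase by a quarter turn, so that [D_{m+1}' = - D_m] with a
    sign independent of the parity of [m].  Repeated integration by parts
    then gives the primitive
      [- sum_{k=m+1}^{m+p+1} x^(p+m+1-k) / (p+m+1-k)! D_k(x)]
    of [x^p / p! D_m(x)] ([clausen_moment_primitive]).  At [x = 0] only its last
    term survives: [D_{p+m+1}(0)] vanishes when [p + m] is odd and is
    [+- zeta(p+m+1)] when [p + m] is even, which is the Kronecker term.

    The analytic point is the identity [D_{m+1}' = - D_m] for [m = 1], where the
    differentiated series is only conditionally convergent.  Away from
    [2 pi Z] the sums of [sin(k x + phi)] are bounded by [1 / |sin(x/2)|]
    ([dirichlet_kernel], [sine_sum_bound]), so summation by parts
    ([abel_summation_bound]) yields local uniform convergence for every
    exponent [m >= 1] ([sine_series_CVU_off_zero]), and termwise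
    differentiation applies.  Since [|2 pi z| < 2 pi], the only point of the
    integration range where this fails is [0].  There the primitive is still
    continuous, because it involves only the [D_k] with [k >= 2], whose series
    converge uniformly on the line ([sine_series_CVU]); so the improper integral
    is the difference of its end values ([is_integral_from_0_derive]). *)

(** * Uniform convergence from a rate *)

(** Common frame for the two kinds of convergence below: a Cauchy estimate
    uniform in [y] produces both the pointwise limit and the uniform
    convergence to it. *)
Lemma CVU_of_rate (fn : nat -> R -> R) (e : nat -> R) (c : R) (r : posreal) :
  (forall n N y, (n <= N)%nat -> Boule c r y -> Rabs (fn N y - fn n y) <= e n) ->
  is_lim_seq e 0 ->
  CVU fn (fun y => real (Lim_seq (fun n => fn n y))) c r.
Proof.
  intros Hrate He.
  assert (Hdom : CVU_dom fn (Boule c r)).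
  2: { intros eps Heps.
       destruct (Hdom (mkposreal eps Heps)) as [N HN].
       exists N; intros n y Hn Hy; rewrite Rabs_minus_sym; apply HN; easy. }
  apply CVU_dom_cauchy; intros eps.
  apply is_lim_seq_spec in He.
  destruct (He (pos_div_2 eps)) as [N HN]; simpl in HN.
  exists N; intros n k y Hy Hn Hk.
  pose proof (Hrate N n y Hn Hy) as H1.
  pose proof (Hrate N k y Hk Hy) as H2.
  pose proof (HN N (le_n N)) as H3; rewrite Rminus_0_r in H3.
  pose proof (Rle_abs (e N)) as H4.
  replace (fn n y - fn k y) with ((fn n y - fn N y) + - (fn k y - fn N y)) by ring.
  pose proof (Rabs_triang (fn n y - fn N y) (- (fn k y - fn N y))) as H5.
  rewrite Rabs_Ropp in H5; lra.
Qed.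

(** Quantitative form of Dirichlet's test.  The bound depends on [b] only through
    [B], hence is uniform in any parameter in which [B] is. *)
Lemma abel_summation_bound (a b : nat -> R) (B : R) :
  (forall n, 0 <= a (S n) <= a n) ->
  (forall n, Rabs (sum_n b n) <= B) ->
  forall n N, (n <= N)%nat ->
  Rabs (sum_n (fun k => a k * b k) N - sum_n (fun k => a k * b k) n)
    <= 2 * B * a n.
Proof.
  intros Ha HB n N HnN.
  set (S_ := sum_n (fun k => a k * b k)).
  assert (Hpos : forall k, 0 <= a k) by (intros k; specialize (Ha k); lra).
  (* Subtracting the boundary term [a k * sum_n b k] leaves a sequence whose
     increments are [(a k - a (k+1)) * sum_n b k], hence of bounded variation. *)
  assert (H : Rabs ((S_ N - a N * sum_n b N) - (S_ n - a n * sum_n b n))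
                <= B * (a n - a N)).
  { induction HnN as [| N HnN IH].
    - rewrite Rminus_diag, Rabs_R0; lra.
    - unfold S_ in *; rewrite !sum_Sn; change plus with Rplus.
      set (s := sum_n (fun k => a k * b k)) in *.
      replace (s N + a (S N) * b (S N) - a (S N) * (sum_n b N + b (S N))
                 - (s n - a n * sum_n b n))
        with ((s N - a N * sum_n b N - (s n - a n * sum_n b n))
                + (a N - a (S N)) * sum_n b N) by ring.
      eapply Rle_trans; [apply Rabs_triang |].
      rewrite Rabs_mult, (Rabs_pos_eq (a N - a (S N)))
        by (specialize (Ha N); lra).
      assert ((a N - a (S N)) * Rabs (sum_n b N) <= (a N - a (S N)) * B).
      { apply Rmult_le_compat_l; [specialize (Ha N); lra | apply HB]. }
      lra. }
  (* The two boundary terms cost [B * a N] and [B * a n]. *)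
  assert (Hb : forall k, Rabs (a k * sum_n b k) <= a k * B).
  { intros k; rewrite Rabs_mult, (Rabs_pos_eq _ (Hpos k)).
    apply Rmult_le_compat_l; auto. }
  replace (S_ N - S_ n)
    with ((S_ N - a N * sum_n b N - (S_ n - a n * sum_n b n))
            + (a N * sum_n b N + - (a n * sum_n b n))) by ring.
  eapply Rle_trans; [apply Rabs_triang |].
  pose proof (Rabs_triang (a N * sum_n b N) (- (a n * sum_n b n))) as Ht.
  rewrite Rabs_Ropp in Ht.
  pose proof (Hb n); pose proof (Hb N); lra.
Qed.

(** * Sine series with a phase *)

Definition sine_partial (s : nat) (phi : R) (n : nat) (x : R) : R :=
  sum_n (fun k => sin (INR (S k) * x + phi) / INR (S k) ^ s) n.

Definition sine_series (s : nat) (phi x : R) : R :=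
  Series (fun k => sin (INR (S k) * x + phi) / INR (S k) ^ s).

Lemma INR_S_pos (k : nat) : 0 < INR (S k).
Proof. apply lt_0_INR; lia. Qed.

Lemma INR_S_pow_pos (k s : nat) : 0 < INR (S k) ^ s.
Proof. apply pow_lt, INR_S_pos. Qed.

(** Multiplying by [2 sin(x/2)] turns the sum into a telescoping one. *)
Lemma dirichlet_kernel (phi x : R) (n : nat) :
  2 * sin (x / 2) * sum_n (fun k => sin (INR (S k) * x + phi)) n
    = cos (x / 2 + phi) - cos (INR (S n) * x + phi + x / 2).
Proof.
  assert (Hstep : forall k, 2 * sin (x / 2) * sin (INR (S k) * x + phi)
    = cos (INR k * x + phi + x / 2) - cos (INR (S k) * x + phi + x / 2)).
  { intros k.
    replace (INR k * x + phi + x / 2) with (INR (S k) * x + phi - x / 2)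
      by (rewrite S_INR; field).
    rewrite cos_minus, (cos_plus (_ + phi)); ring. }
  induction n as [| n IH].
  - rewrite sum_O, Hstep.
    replace (INR 0 * x + phi + x / 2) with (x / 2 + phi) by (simpl; ring).
    reflexivity.
  - rewrite sum_Sn; change plus with Rplus.
    rewrite Rmult_plus_distr_l, IH, Hstep. ring.
Qed.

Lemma sine_sum_bound (phi x d : R) (n : nat) :
  0 < d -> d <= Rabs (sin (x / 2)) ->
  Rabs (sum_n (fun k => sin (INR (S k) * x + phi)) n) <= / d.
Proof.
  intros Hd Hx.
  set (s := sum_n _ n).
  assert (Hk : Rabs (2 * sin (x / 2) * s) <= 2).
  { unfold s; rewrite dirichlet_kernel.
    apply Rabs_le.
    pose proof (COS_bound (x / 2 + phi)).
    pose proof (COS_bound (INR (S n) * x + phi + x / 2)); lra. }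
  rewrite !Rabs_mult, (Rabs_pos_eq 2) in Hk by lra.
  apply (Rmult_le_reg_l d); [easy |].
  rewrite Rinv_r by lra.
  pose proof (Rmult_le_compat_r (Rabs s) _ _ (Rabs_pos s) Hx); lra.
Qed.

Lemma inv_pow_decreasing (s n : nat) :
  0 <= / INR (S (S n)) ^ s <= / INR (S n) ^ s.
Proof.
  split; [left; apply Rinv_0_lt_compat, INR_S_pow_pos |].
  apply Rinv_le_contravar; [apply INR_S_pow_pos |].
  apply pow_incr; split; [left; apply INR_S_pos | apply le_INR; lia].
Qed.

Lemma is_lim_seq_inv_INR_S : is_lim_seq (fun n => / INR (S n)) 0.
Proof.
  apply (is_lim_seq_incr_1 (fun n => / INR n)).
  apply (is_lim_seq_inv INR p_infty); [apply is_lim_seq_INR | easy].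
Qed.

Lemma inv_pow_le_inv (s n : nat) :
  (1 <= s)%nat -> / INR (S n) ^ s <= / INR (S n).
Proof.
  intros Hs; apply Rinv_le_contravar; [apply INR_S_pos |].
  rewrite <- (pow_1 (INR (S n))) at 1.
  apply Rle_pow; [rewrite S_INR; pose proof (pos_INR n); lra | easy].
Qed.

(** The radius does not depend on the phase: it is only chosen to keep
    [|sin(y/2)|] above half of its value at [x]. *)
Lemma sine_series_CVU_off_zero (s : nat) (x : R) :
  (1 <= s)%nat -> sin (x / 2) <> 0 ->
  exists r : posreal, forall phi,
    CVU (sine_partial s phi) (sine_series s phi) x r.
Proof.
  intros Hs Hx.
  set (d := Rabs (sin (x / 2)) / 2).
  assert (Hd : 0 < d) by (pose proof (Rabs_pos_lt _ Hx); unfold d; lra).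
  assert (Hc : continuous (fun y => Rabs (sin (y / 2))) x).
  { apply (continuous_comp (fun y => sin (y / 2)) Rabs);
      [| apply continuous_Rabs].
    apply (ex_derive_continuous (fun y => sin (y / 2))); auto_derive; easy. }
  assert (Hloc : locally x (fun y => d < Rabs (sin (y / 2)))).
  { apply Hc, open_gt; unfold d in *; lra. }
  destruct Hloc as [r Hr]; exists r; intros phi.
  apply (CVU_of_rate _ (fun n => 2 * / d * / INR (S n))).
  - intros n N y HnN Hy.
    assert (Hext : forall M, sine_partial s phi M y
      = sum_n (fun k => / INR (S k) ^ s * sin (INR (S k) * y + phi)) M).
    { intros M; apply sum_n_ext; intros k; apply Rmult_comm. }
    rewrite !Hext.
    eapply Rle_trans.
    + apply (abel_summation_bound (fun k => / INR (S k) ^ s)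
               (fun k => sin (INR (S k) * y + phi)) (/ d)); [| | easy].
      * intros k; apply inv_pow_decreasing.
      * intros k; apply sine_sum_bound; [easy |].
        left; apply Hr, Hy.
    + apply Rmult_le_compat_l; [pose proof (Rinv_0_lt_compat _ Hd); lra |].
      apply inv_pow_le_inv, Hs.
  - rewrite <- (Rmult_0_r (2 * / d)).
    apply (is_lim_seq_scal_l _ (2 * / d) 0), is_lim_seq_inv_INR_S.
Qed.

(** For [s >= 2] the terms are dominated by [1/(k(k-1)) = 1/(k-1) - 1/k], whose
    tails telescope. *)
Lemma sine_series_CVU (s : nat) (phi x : R) (r : posreal) :
  (2 <= s)%nat -> CVU (sine_partial s phi) (sine_series s phi) x r.
Proof.
  intros Hs.
  apply (CVU_of_rate _ (fun n => / INR (S n))); [| apply is_lim_seq_inv_INR_S].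
  intros n N y HnN _.
  assert (H : Rabs (sine_partial s phi N y - sine_partial s phi n y)
                <= / INR (S n) - / INR (S N)).
  { induction HnN as [| N HnN IH].
    - rewrite !Rminus_diag, Rabs_R0; lra.
    - unfold sine_partial in *; rewrite sum_Sn; change plus with Rplus.
      set (t := sin (INR (S (S N)) * y + phi) / INR (S (S N)) ^ s).
      assert (Ht : Rabs t <= / INR (S N) - / INR (S (S N))).
      { unfold t; rewrite Rabs_div, (Rabs_pos_eq (INR (S (S N)) ^ s))
          by (pose proof (INR_S_pow_pos (S N) s); lra).
        apply Rle_trans with (/ INR (S (S N)) ^ 2).
        - apply Rle_trans with (1 * / INR (S (S N)) ^ s).
          + apply Rmult_le_compat_r.
            * left; apply Rinv_0_lt_compat, INR_S_pow_pos.
            * apply Rabs_le, SIN_bound.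
          + rewrite Rmult_1_l; apply Rinv_le_contravar; [apply INR_S_pow_pos |].
            apply Rle_pow; [| easy].
            rewrite S_INR; pose proof (pos_INR (S N)); lra.
        - pose proof (INR_S_pos N) as HN; rewrite (S_INR (S N)).
          replace (/ INR (S N) - / (INR (S N) + 1))
            with (/ (INR (S N) * (INR (S N) + 1))) by (field; lra).
          apply Rinv_le_contravar; nra. }
      match goal with |- Rabs (?u + t - ?v) <= _ =>
        replace (u + t - v) with ((u - v) + t) by ring end.
      eapply Rle_trans; [apply Rabs_triang |]; lra. }
  pose proof (Rinv_0_lt_compat _ (INR_S_pos N)); lra.
Qed.

Lemma sine_partial_derive (s : nat) (phi : R) (n : nat) (x : R) :
  is_derive (sine_partial (S s) phi n) x (sine_partial s (phi + PI / 2) n x).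
Proof.
  apply (is_derive_sum_n
           (fun k y => sin (INR (S k) * y + phi) / INR (S k) ^ S s)).
  intros k _.
  pose proof (INR_S_pos k); pose proof (INR_S_pow_pos k s).
  auto_derive; [easy |].
  replace (INR (S k) * x + (phi + PI / 2)) with (PI / 2 + (INR (S k) * x + phi))
    by ring.
  rewrite <- cos_sin.
  change (match k with O => 1 | S _ => INR k + 1 end) with (INR (S k)).
  field; split; lra.
Qed.

(** Termwise differentiation needs only the differentiated series, of exponent
    [s >= 1], to converge locally uniformly; this covers the conditionally
    convergent case [s = 1]. *)
Lemma sine_series_derive (s : nat) (phi x : R) :
  (1 <= s)%nat -> sin (x / 2) <> 0 ->
  is_derive (sine_series (S s) phi) x (sine_series s (phi + PI / 2) x).
Proof.
  intros Hs Hx.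
  destruct (sine_series_CVU_off_zero s x Hs Hx) as [r Hr].
  apply is_derive_Reals.
  apply (CVU_derivable (sine_partial (S s) phi) (sine_partial s (phi + PI / 2))
           (sine_series (S s) phi) (sine_series s (phi + PI / 2)) x r).
  - apply Hr.
  - apply CVU_cv, sine_series_CVU; lia.
  - intros n y _; apply is_derive_Reals, sine_partial_derive.
  - unfold Boule; rewrite Rminus_diag, Rabs_R0; apply cond_pos.
Qed.

Lemma sine_series_continuous_of_CVU (s : nat) (phi x : R) (r : posreal) :
  (1 <= s)%nat -> CVU (sine_partial s phi) (sine_series s phi) x r ->
  continuous (sine_series s phi) x.
Proof.
  intros Hs Hr.
  apply continuity_pt_filterlim.
  apply (CVU_continuity _ _ _ _ Hr).
  - intros n y _; apply continuity_pt_filterlim.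
    destruct s as [| s]; [lia |].
    apply (ex_derive_continuous (sine_partial (S s) phi n)).
    eexists; apply sine_partial_derive.
  - unfold Boule; rewrite Rminus_diag, Rabs_R0; apply cond_pos.
Qed.

(** * Clausen functions as sine series *)

(** [(-1) ^ (m / 2) * Cl m], by [signed_Cl_eq]; as a phase-shifted sine series it
    needs no case distinction on the parity of [m]. *)
Definition signed_Cl (m : nat) : R -> R := sine_series m (INR m * PI / 2).

Lemma sin_add_half_pi_multiple (m : nat) (t : R) :
  sin (t + INR m * PI / 2)
    = (-1) ^ (m / 2) * (if Nat.even m then sin t else cos t).
Proof.
  revert t; induction m as [m IH] using (well_founded_induction Nat.lt_wf_0); intros t.
  destruct m as [| [| m]].
  - simpl; replace (t + 0 * PI / 2) with t by field; ring.
  - simpl; replace (t + 1 * PI / 2) with (PI / 2 + t) by field.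
    rewrite <- cos_sin; ring.
  - replace (S (S m) / 2)%nat with (S (m / 2))
      by (replace (S (S m)) with (m + 1 * 2)%nat by lia;
          rewrite Nat.div_add by lia; lia).
    change (Nat.even (S (S m))) with (Nat.even m).
    replace (t + INR (S (S m)) * PI / 2) with (t + INR m * PI / 2 + PI)
      by (rewrite !S_INR; field).
    rewrite neg_sin, IH by lia; simpl; ring.
Qed.

Lemma signed_Cl_eq (m : nat) (x : R) : signed_Cl m x = (-1) ^ (m / 2) * Cl m x.
Proof.
  unfold signed_Cl, sine_series, Cl.
  destruct (Nat.even m) eqn:E; rewrite <- Series_scal_l; apply Series_ext;
    intros k; rewrite sin_add_half_pi_multiple, E; unfold Rdiv; ring.
Qed.

(** The derivative of [sin(k x + (m+1) pi/2)] has phase [(m+2) pi/2], a half turn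
    away from that of [signed_Cl m]; the half turn is the minus sign. *)
Lemma signed_Cl_derive (m : nat) (x : R) :
  (1 <= m)%nat -> sin (x / 2) <> 0 ->
  is_derive (signed_Cl (S m)) x (- signed_Cl m x).
Proof.
  intros Hm Hx.
  replace (- signed_Cl m x)
    with (sine_series m (INR (S m) * PI / 2 + PI / 2) x).
  - apply sine_series_derive; easy.
  - unfold signed_Cl, sine_series.
    rewrite <- Series_opp; apply Series_ext; intros k.
    replace (INR (S k) * x + (INR (S m) * PI / 2 + PI / 2))
      with (INR (S k) * x + INR m * PI / 2 + PI) by (rewrite (S_INR m); field).
    rewrite neg_sin; unfold Rdiv; ring.
Qed.

Lemma signed_Cl_continuous_off_zero (m : nat) (x : R) :
  (1 <= m)%nat -> sin (x / 2) <> 0 -> continuous (signed_Cl m) x.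
Proof.
  intros Hm Hx.
  destruct (sine_series_CVU_off_zero m x Hm Hx) as [r Hr].
  apply (sine_series_continuous_of_CVU _ _ _ r); [easy | apply Hr].
Qed.

Lemma signed_Cl_continuous (m : nat) (x : R) :
  (2 <= m)%nat -> continuous (signed_Cl m) x.
Proof.
  intros Hm.
  apply (sine_series_continuous_of_CVU _ _ _ (mkposreal 1 Rlt_0_1)); [lia |].
  apply sine_series_CVU, Hm.
Qed.

Lemma signed_Cl_at_0 (n : nat) :
  signed_Cl n 0 = if Nat.even n then 0 else (-1) ^ (n / 2) * zeta (INR n).
Proof.
  rewrite signed_Cl_eq; unfold Cl, zeta.
  destruct (Nat.even n) eqn:E.
  - rewrite (Series_ext _ (fun _ => 0 * 0)).
    + rewrite Series_scal_l; ring.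
    + intros k; rewrite Rmult_0_r, sin_0; unfold Rdiv; ring.
  - f_equal; apply Series_ext; intros k.
    rewrite Rmult_0_r, cos_0, Rpower_pow by apply INR_S_pos.
    unfold Rdiv; ring.
Qed.

(** * The antiderivative *)

(** The sum of the theorem, divided by [p! (-1)^(m/2)] and with each
    [(-1) ^ (k / 2)] absorbed in [signed_Cl k]. *)
Definition clausen_moment_primitive (p m : nat) (x : R) : R :=
  - sum_n_m (fun k => x ^ (p + m + 1 - k) / INR (fact (p + m + 1 - k))
                        * signed_Cl k x) (m + 1) (m + p + 1).

Lemma clausen_moment_primitive_0 (m : nat) (x : R) :
  clausen_moment_primitive 0 m x = - signed_Cl (S m) x.
Proof.
  unfold clausen_moment_primitive.
  replace (m + 0 + 1)%nat with (m + 1)%nat by lia.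
  rewrite sum_n_n.
  replace (0 + m + 1 - (m + 1))%nat with 0%nat by lia.
  replace (m + 1)%nat with (S m) by lia; simpl; field.
Qed.

(** Integration by parts: splitting off the first term of the sum leaves the same
    sum for [p] and [m + 1].  The facts below follow from this recursion by
    induction on [p]. *)
Lemma clausen_moment_primitive_S (p m : nat) (x : R) :
  clausen_moment_primitive (S p) m x
    = - (x ^ S p / INR (fact (S p)) * signed_Cl (S m) x)
        + clausen_moment_primitive p (S m) x.
Proof.
  unfold clausen_moment_primitive.
  rewrite sum_Sn_m by lia.
  replace (S p + m + 1 - (m + 1))%nat with (S p) by lia.
  replace (S (m + 1)) with (S m + 1)%nat by lia.
  replace (m + S p + 1)%nat with (S m + p + 1)%nat by lia.
  replace (S p + m + 1)%nat with (p + S m + 1)%nat by lia.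
  replace (m + 1)%nat with (S m) by lia.
  change plus with Rplus; ring.
Qed.

(** In the derivative of the term split off by [clausen_moment_primitive_S], the
    part [- x^p/p! D_{m+1}] cancels the derivative of the remaining sum. *)
Lemma clausen_moment_primitive_derive (p m : nat) (x : R) :
  (1 <= m)%nat -> sin (x / 2) <> 0 ->
  is_derive (clausen_moment_primitive p m) x
    (x ^ p / INR (fact p) * signed_Cl m x).
Proof.
  revert m; induction p as [| p IH]; intros m Hm Hx.
  - apply (is_derive_ext (fun y => - signed_Cl (S m) y)).
    { intros y; symmetry; apply clausen_moment_primitive_0. }
    replace (x ^ 0 / INR (fact 0) * signed_Cl m x) with (- - signed_Cl m x)
      by (simpl; field).
    apply (is_derive_opp (signed_Cl (S m))), signed_Cl_derive; easy.
  - apply (is_derive_ext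
             (fun y => - (y ^ S p / INR (fact (S p)) * signed_Cl (S m) y)
                         + clausen_moment_primitive p (S m) y)).
    { intros y; symmetry; apply clausen_moment_primitive_S. }
    assert (Hf : is_derive (fun y => y ^ S p / INR (fact (S p))) x
                   (x ^ p / INR (fact p))).
    { pose proof (INR_fact_neq_0 p) as Hp.
      pose proof (not_0_INR (S p) ltac:(lia)) as HSp.
      auto_derive; [easy |].
      change (pred (S p)) with p.
      change (match p with O => 1 | S _ => INR p + 1 end) with (INR (S p)).
      change (fact p + p * fact p)%nat with (S p * fact p)%nat.
      rewrite mult_INR; field; easy. }
    replace (x ^ S p / INR (fact (S p)) * signed_Cl m x)
      with (- (x ^ p / INR (fact p) * signed_Cl (S m) x
               + x ^ S p / INR (fact (S p)) * (- signed_Cl m x))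
            + x ^ p / INR (fact p) * signed_Cl (S m) x) by ring.
    apply (is_derive_plus (V := R_NormedModule)); [| apply IH; [lia | easy]].
    apply (is_derive_opp (V := R_NormedModule)).
    apply (is_derive_mult (fun y => y ^ S p / INR (fact (S p))) (signed_Cl (S m)));
      [easy | apply signed_Cl_derive; easy | intros; apply Rmult_comm].
Qed.

Lemma pow_div_fact_continuous (p : nat) (x : R) :
  continuous (fun y => y ^ p / INR (fact p)) x.
Proof.
  apply (ex_derive_continuous (fun y => y ^ p / INR (fact p))).
  auto_derive; easy.
Qed.

Lemma clausen_moment_primitive_continuous (p m : nat) (x : R) :
  (1 <= m)%nat -> continuous (clausen_moment_primitive p m) x.
Proof.
  revert m; induction p as [| p IH]; intros m Hm.
  - apply (continuous_ext (fun y => - signed_Cl (S m) y)).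
    { intros y; symmetry; apply clausen_moment_primitive_0. }
    apply (continuous_opp (signed_Cl (S m))), signed_Cl_continuous; lia.
  - apply (continuous_ext
             (fun y => - (y ^ S p / INR (fact (S p)) * signed_Cl (S m) y)
                         + clausen_moment_primitive p (S m) y)).
    { intros y; symmetry; apply clausen_moment_primitive_S. }
    apply (continuous_plus (V := R_NormedModule)); [| apply IH; lia].
    apply (continuous_opp (V := R_NormedModule)).
    apply (continuous_mult (K := R_AbsRing));
      [apply pow_div_fact_continuous | apply signed_Cl_continuous; lia].
Qed.

Lemma clausen_moment_primitive_at_0 (p m : nat) :
  clausen_moment_primitive p m 0 = - signed_Cl (p + m + 1) 0.
Proof.
  revert m; induction p as [| p IH]; intros m.
  - rewrite clausen_moment_primitive_0; do 2 f_equal; lia.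
  - rewrite clausen_moment_primitive_S, IH, pow_i by lia.
    replace (p + S m + 1)%nat with (S p + m + 1)%nat by lia.
    unfold Rdiv; ring.
Qed.

(** * The improper integral *)

(** The fundamental theorem of calculus on [[e b, b]], followed by [e -> 0+].
    Nothing is asked of [f] at [0], where [Cl 1] is unbounded. *)
Lemma is_integral_from_0_derive (F f : R -> R) (b : R) :
  continuous F 0 ->
  (forall x, x <> 0 -> Rabs x <= Rabs b -> is_derive F x (f x)) ->
  (forall x, x <> 0 -> Rabs x <= Rabs b -> continuous f x) ->
  is_integral_from_0 f b (F b - F 0).
Proof.
  intros HF Hd Hc.
  assert (HI : forall e, 0 < e <= 1 -> is_RInt f (e * b) b (F b - F (e * b))).
  { intros e He.
    destruct (Req_dec b 0) as [-> | Hb].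
    (* The derivative hypotheses say nothing at the single point [x = 0]. *)
    { rewrite Rmult_0_r, Rminus_diag; apply (is_RInt_point f 0). }
    assert (Hx : forall x, Rmin (e * b) b <= x <= Rmax (e * b) b ->
                   x <> 0 /\ Rabs x <= Rabs b).
    { intros x Hx; destruct (Rlt_or_le 0 b).
      - rewrite Rmin_left, Rmax_right in Hx by nra.
        assert (0 < x) by nra.
        rewrite !Rabs_pos_eq by lra; lra.
      - rewrite Rmin_right, Rmax_left in Hx by nra.
        assert (x < 0) by nra.
        rewrite !Rabs_left by lra; lra. }
    apply (is_RInt_derive (V := R_CompleteNormedModule) F f);
      intros x H; destruct (Hx x H); auto. }
  intros P HP.
  assert (Hlim : filterlim (fun e => F b - F (e * b)) (at_right 0)
                   (locally (F b - F 0))).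
  { apply (filterlim_filter_le_1 (F := locally 0) (G := at_right 0));
      [apply filter_le_within |].
    assert (Hcont : continuous (fun e => F b - F (e * b)) 0).
    { apply (continuous_minus (V := R_NormedModule)); [apply continuous_const |].
      apply (continuous_comp (fun e => e * b) F).
      - apply (ex_derive_continuous (fun e => e * b)); auto_derive; easy.
      - rewrite Rmult_0_l; exact HF. }
    unfold continuous in Hcont; rewrite Rmult_0_l in Hcont; exact Hcont. }
  apply (Filter_prod _ _ _
           (fun a => exists y, is_RInt f a b y /\ P y) (fun c => c = b)).
  - unfold filtermap.
    assert (H1 : at_right 0 (fun e => 0 < e <= 1)).
    { exists (mkposreal 1 Rlt_0_1); intros e He He0; split; [easy |].
      change (Rabs (e - 0) < 1) in He; apply Rabs_def2 in He; lra. }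
    generalize (filter_and _ _ H1 (Hlim P HP)); apply filter_imp.
    intros e [He HPe]; exists (F b - F (e * b)); auto.
  - reflexivity.
  - intros a c Ha ->; exact Ha.
Qed.

(** * Moments of the Clausen functions *)

Lemma sin_half_neq_0 (x : R) : x <> 0 -> Rabs x < 2 * PI -> sin (x / 2) <> 0.
Proof.
  intros Hx0 Hx; apply Rabs_def2 in Hx.
  destruct (Rlt_or_le 0 x).
  - pose proof (sin_gt_0 (x / 2)); lra.
  - pose proof (sin_gt_0 (- (x / 2))) as H1; rewrite sin_neg in H1; lra.
Qed.

Lemma kronecker_half (n : nat) :
  kronecker (INR (n / 2)) (INR n / 2) = if Nat.even n then 1 else 0.
Proof.
  unfold kronecker.
  pose proof (Nat.div_mod_eq n 2) as Hn.
  assert (HR : INR n = 2 * INR (n / 2) + INR (n mod 2)).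
  { rewrite Hn at 1; rewrite plus_INR, mult_INR; reflexivity. }
  destruct (Nat.even n) eqn:E.
  - assert (Hm : (n mod 2 = 0)%nat).
    { apply Nat.even_spec in E; destruct E as [q ->].
      rewrite Nat.mul_comm; apply Nat.Div0.mod_mul. }
    rewrite Hm in HR; cbn [INR] in HR.
    destruct Req_EM_T; lra.
  - assert (Hm : (n mod 2 = 1)%nat).
    { pose proof (Nat.mod_upper_bound n 2 ltac:(easy)).
      assert (n mod 2 <> 0)%nat; [intros H0 | lia].
      assert (Nat.even n = true); [| congruence].
      apply Nat.even_spec; exists (n / 2)%nat; lia. }
    rewrite Hm in HR; cbn [INR] in HR.
    destruct Req_EM_T; lra.
Qed.

Lemma pow_neg1_sqr (n : nat) : (-1) ^ n * (-1) ^ n = 1.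
Proof. rewrite <- Rpow_mult_distr; replace (-1 * -1) with 1 by ring; apply pow1. Qed.

Theorem theorem3p1 (p m : nat) (z : R) (hm : (1 <= m)%nat) (hz : Rabs z < 1) :
  is_integral_from_0 (fun x : R => x ^ p * Cl m x) (2 * PI * z)
    (- sum_n_m (fun k : nat =>
          (2 * PI * z) ^ (p + m + 1 - k) * INR (fact p)
            * (-1) ^ (m / 2) * (-1) ^ (k / 2)
            / INR (fact (p + m + 1 - k)) * Cl k (2 * PI * z))
        (m + 1) (m + p + 1)
     + kronecker (INR ((p + m) / 2)) (INR (p + m) / 2)
         * (-1) ^ (m / 2) * INR (fact p) * (-1) ^ ((p + m) / 2)
         * zeta (INR (p + m + 1))).
Proof.
  set (b := 2 * PI * z).
  set (c := INR (fact p) * (-1) ^ (m / 2)).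
  set (F := fun x => c * clausen_moment_primitive p m x).
  assert (Hb : Rabs b < 2 * PI).
  { unfold b; pose proof PI_RGT_0.
    rewrite Rabs_mult, (Rabs_pos_eq (2 * PI)) by lra; nra. }
  (* [(-1) ^ (m / 2)] is its own inverse. *)
  assert (Hf : forall x,
             x ^ p * Cl m x = c * (x ^ p / INR (fact p) * signed_Cl m x)).
  { intros x; rewrite signed_Cl_eq; unfold c.
    transitivity ((-1) ^ (m / 2) * (-1) ^ (m / 2) * (x ^ p * Cl m x));
      [rewrite pow_neg1_sqr; ring | field; apply INR_fact_neq_0]. }
  match goal with |- is_integral_from_0 _ _ ?l =>
    replace l with (F b - F 0) end.
  - apply is_integral_from_0_derive.
    + apply (continuous_scal_r (V := R_NormedModule) c).
      apply clausen_moment_primitive_continuous, hm.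
    + intros x Hx0 Hx; rewrite Hf.
      apply (is_derive_scal (clausen_moment_primitive p m)).
      apply clausen_moment_primitive_derive; [easy |].
      apply sin_half_neq_0; lra.
    + intros x Hx0 Hx.
      apply (continuous_ext
               (fun y => c * (y ^ p / INR (fact p) * signed_Cl m y)));
        [intros y; symmetry; apply Hf |].
      apply (continuous_scal_r (V := R_NormedModule) c).
      apply (continuous_mult (K := R_AbsRing)); [apply pow_div_fact_continuous |].
      apply signed_Cl_continuous_off_zero; [easy |].
      apply sin_half_neq_0; lra.
  - unfold F at 2; rewrite clausen_moment_primitive_at_0, signed_Cl_at_0.
    unfold Rminus; f_equal.
    + unfold F, clausen_moment_primitive.
      rewrite <- Ropp_mult_distr_r; f_equal.
      rewrite <- (sum_n_m_mult_l (K := R_Ring) c).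
      apply sum_n_m_ext; intros k; rewrite signed_Cl_eq; unfold c.
      change mult with Rmult; unfold Rdiv.
      match goal with |- ?u = ?v => change (@eq R u v) end; ring.
    + rewrite kronecker_half; unfold c.
      rewrite Nat.add_1_r, Nat.even_succ, <- Nat.negb_even.
      destruct (Nat.even (p + m)) eqn:E; simpl negb; cbv iota; [| ring].
      (* The phase of [signed_Cl (p + m + 1)] brings the exponent
         [(p + m + 1) / 2], equal to [(p + m) / 2] when [p + m] is even. *)
      replace (S (p + m) / 2)%nat with ((p + m) / 2)%nat; [ring |].
      apply Nat.even_spec in E; destruct E as [q ->].
      replace (S (2 * q)) with (1 + q * 2)%nat by lia.
      rewrite Nat.div_add, (Nat.mul_comm 2), Nat.div_mul by lia; reflexivity.
Qed.
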